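(* Let $(E_6)^\sigma=\{\alpha\in E_6\mid\sigma\alpha=\alpha\sigma\}$. Then there is an isomorphism of groups $$(E_6)^\sigma\cong(U(1)\times Spin(10))/\mathbb Z_4,\qquad \mathbb Z_4=\{(1,\phi(1)),(-1,\phi(-1)),(i,\phi(-i)),(-i,\phi(i))\},$$ where $Spin(10)$ is realized as the subgroup $(E_6)_{E_1}=\{\alpha\in E_6\mid\alpha E_1=E_1\}$ of $E_6$.
   Context: $\mathbb H$ is the field of quaternions with basis $1,e_1,e_2,e_3$; the Cayley algebra is $\mathfrak C=\mathbb H\oplus\mathbb He_4$ with $(m+ae_4)(n+be_4)=(mn-\overline b a)+(a\overline n+bm)e_4$, $\overline{m+ae_4}=\overline m-ae_4$. $\mathfrak J=\{X\in M(3,\mathfrak C)\mid X^*=X\}$ with $X\circ Y=\frac12(XY+YX)$, $\mathrm{tr}(X)$ the sum of diagonal entries, $(X,Y)=\mathrm{tr}(X\circ Y)$, $X\times Y=\frac12(2X\circ Y-\mathrm{tr}(X)Y-\mathrm{tr}(Y)X+(\mathrm{tr}(X)\mathrm{tr}(Y)-(X,Y))E)$, $\det X=\frac13(X,X\times X)$. $\mathfrak J^{\mathbb C}=\{X_1+iX_2\mid X_j\in\mathfrak J\}$ is the complexification with these operations (and the conjugation $x\mapsto\overline x$ of $\mathfrak C$) extended complex (multi)linearly, $\tau(X_1+iX_2)=X_1-iX_2$, $\langle X,Y\rangle=(\tau X,Y)$. $E_6$ is the group of $\mathbb C$-linear isomorphisms $\alpha$ of $\mathfrak J^{\mathbb C}$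 with $\det(\alpha X)=\det X$ and $\langle\alpha X,\alpha Y\rangle=\langle X,Y\rangle$. $E_1=\mathrm{diag}(1,0,0)$. For $\theta\in\mathbb C$, $\theta\ne0$, $\phi(\theta):\mathfrak J^{\mathbb C}\to\mathfrak J^{\mathbb C}$ is $\phi(\theta)\begin{pmatrix}\xi_1&x_3&\overline x_2\\ \overline x_3&\xi_2&x_1\\ x_2&\overline x_1&\xi_3\end{pmatrix}=\begin{pmatrix}\theta^4\xi_1&\theta x_3&\theta\overline x_2\\ \theta\overline x_3&\theta^{-2}\xi_2&\theta^{-2}x_1\\ \theta x_2&\theta^{-2}\overline x_1&\theta^{-2}\xi_3\end{pmatrix}$, and $\sigma$ is the $\mathbb C$-linear map changing the signs of $x_2$ and $x_3$ and fixing $\xi_1,\xi_2,\xi_3,x_1$ (so $\sigma\in E_6$, $\sigma^2=1$). $U(1)=\{\theta\in\mathbb C\mid|\theta|=1\}$. The group $(E_6)_{E_1}$ is isomorphic to $Spin(10)$, the universal covering group of $SO(10)$, and the paper identifies the two; $\phi(\theta)\in(E_6)_{E_1}$ when $\theta^4=1$. *)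

(* Defs.v *)
(* MathComp, with R : realType for the real numbers and R[i] for the complex
   numbers. *)
From HB Require Import structures.
From mathcomp Require Import all_boot all_order all_algebra.
From mathcomp Require Import complex.
From mathcomp Require Import boolp classical_sets reals.
From mathcomp Require Import ring.

Set Implicit Arguments.
Unset Strict Implicit.
Unset Printing Implicit Defensive.

Import Order.TTheory GRing.Theory Num.Theory.

Local Open Scope classical_set_scope.
Local Open Scope ring_scope.

(* Everything up to the Freudenthal product and the determinant is written over
   an arbitrary field K: K = R gives the real Cayley algebra and the real
   Jordan algebra, and K = R[i] gives their complexifications, because the
   operations are then the C-multilinear extensions of the real ones; this is
   [jordan_complexification], [jmap_mul], [jmap_tr] and the linearity lemmas
   below. *)

(* Quat a0 a1 a2 a3 is a0 + a1 e1 + a2 e2 + a3 e3. *)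
Record quat (K : fieldType) : Type := Quat { q0 : K; q1 : K; q2 : K; q3 : K }.

(* Cayley m a is m + a e4. *)
Record cayley (K : fieldType) : Type := Cayley { cm : quat K; ca : quat K }.

Section QuatModule.
Variable K : fieldType.
Implicit Types a b : quat K.

Let tuple_of_quat a := (q0 a, q1 a, q2 a, q3 a).
Let quat_of_tuple (t : K * K * K * K) :=
  let: (a0, a1, a2, a3) := t in Quat a0 a1 a2 a3.
Let tuple_of_quatK : cancel tuple_of_quat quat_of_tuple.
Proof. by case. Qed.
HB.instance Definition _ := Choice.copy (quat K) (can_type tuple_of_quatK).

Definition qzero : quat K := Quat 0 0 0 0.
Definition qopp a : quat K := Quat (- q0 a) (- q1 a) (- q2 a) (- q3 a).
Definition qadd a b : quat K :=
  Quat (q0 a + q0 b) (q1 a + q1 b) (q2 a + q2 b) (q3 a + q3 b).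
Definition qscale k a : quat K :=
  Quat (k * q0 a) (k * q1 a) (k * q2 a) (k * q3 a).

Let qaddA : associative qadd.
Proof. by move=> a b c; congr Quat; apply: addrA. Qed.
Let qaddC : commutative qadd.
Proof. by move=> a b; congr Quat; apply: addrC. Qed.
Let qadd0 : left_id qzero qadd.
Proof. by case=> *; congr Quat; apply: add0r. Qed.
Let qaddN : left_inverse qzero qopp qadd.
Proof. by move=> a; congr Quat; apply: addNr. Qed.
HB.instance Definition _ := GRing.isZmodule.Build (quat K) qaddA qaddC qadd0 qaddN.

Let qscaleA k l a : qscale k (qscale l a) = qscale (k * l) a.
Proof. by congr Quat; apply: mulrA. Qed.
Let qscale1 : left_id 1 qscale.
Proof. by case=> *; congr Quat; apply: mul1r. Qed.
Let qscaleDr : right_distributive qscale +%R.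
Proof. by move=> k a b; congr Quat; apply: mulrDr. Qed.
Let qscaleDl a : {morph qscale^~ a : k l / k + l}.
Proof. by move=> k l; congr Quat; apply: mulrDl. Qed.
HB.instance Definition _ := GRing.Zmodule_isLmodule.Build K (quat K)
  qscaleA qscale1 qscaleDr qscaleDl.

End QuatModule.

Section CayleyModule.
Variable K : fieldType.
Implicit Types x y : cayley K.

Let pair_of_cayley x := (cm x, ca x).
Let cayley_of_pair (p : quat K * quat K) := Cayley p.1 p.2.
Let pair_of_cayleyK : cancel pair_of_cayley cayley_of_pair.
Proof. by case. Qed.
HB.instance Definition _ := Choice.copy (cayley K) (can_type pair_of_cayleyK).

Definition czero : cayley K := Cayley 0 0.
Definition copp x : cayley K := Cayley (- cm x) (- ca x).
Definition cadd x y : cayley K := Cayley (cm x + cm y) (ca x + ca y).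
Definition cscale (k : K) x : cayley K := Cayley (k *: cm x) (k *: ca x).

Let caddA : associative cadd.
Proof. by move=> x y z; congr Cayley; apply: addrA. Qed.
Let caddC : commutative cadd.
Proof. by move=> x y; congr Cayley; apply: addrC. Qed.
Let cadd0 : left_id czero cadd.
Proof. by case=> *; congr Cayley; apply: add0r. Qed.
Let caddN : left_inverse czero copp cadd.
Proof. by move=> x; congr Cayley; apply: addNr. Qed.
HB.instance Definition _ :=
  GRing.isZmodule.Build (cayley K) caddA caddC cadd0 caddN.

Let cscaleA k l x : cscale k (cscale l x) = cscale (k * l) x.
Proof. by congr Cayley; apply: scalerA. Qed.
Let cscale1 : left_id 1 cscale.
Proof. by case=> *; congr Cayley; apply: scale1r. Qed.
Let cscaleDr : right_distributive cscale +%R.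
Proof. by move=> k x y; congr Cayley; apply: scalerDr. Qed.
Let cscaleDl x : {morph cscale^~ x : k l / k + l}.
Proof. by move=> k l; congr Cayley; apply: scalerDl. Qed.
HB.instance Definition _ := GRing.Zmodule_isLmodule.Build K (cayley K)
  cscaleA cscale1 cscaleDr cscaleDl.

End CayleyModule.

Section Cayley.
Variable K : fieldType.

Definition qmul (a b : quat K) : quat K :=
  let: Quat a0 a1 a2 a3 := a in
  let: Quat b0 b1 b2 b3 := b in
  Quat (a0 * b0 - a1 * b1 - a2 * b2 - a3 * b3)
       (a0 * b1 + a1 * b0 + a2 * b3 - a3 * b2)
       (a0 * b2 - a1 * b3 + a2 * b0 + a3 * b1)
       (a0 * b3 + a1 * b2 - a2 * b1 + a3 * b0).

Definition qconj (a : quat K) : quat K :=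
  let: Quat a0 a1 a2 a3 := a in Quat a0 (- a1) (- a2) (- a3).

Definition cmul (x y : cayley K) : cayley K :=
  let: Cayley m a := x in
  let: Cayley n b := y in
  Cayley (qmul m n - qmul (qconj b) a) (qmul a (qconj n) + qmul b m).

Definition cconj (x : cayley K) : cayley K :=
  let: Cayley m a := x in Cayley (qconj m) (- a).

Definition cone : cayley K := Cayley (Quat 1 0 0 0) 0.

(* The coefficient of 1. *)
Definition cre (x : cayley K) : K := q0 (cm x).

Lemma cayley_ext (x y : cayley K) :
  q0 (cm x) = q0 (cm y) -> q1 (cm x) = q1 (cm y) ->
  q2 (cm x) = q2 (cm y) -> q3 (cm x) = q3 (cm y) ->
  q0 (ca x) = q0 (ca y) -> q1 (ca x) = q1 (ca y) ->
  q2 (ca x) = q2 (ca y) -> q3 (ca x) = q3 (ca y) -> x = y.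
Proof.
move: x y => [[x0 x1 x2 x3] [x4 x5 x6 x7]] [[y0 y1 y2 y3] [y4 y5 y6 y7]] /=.
by move=> -> -> -> -> -> -> -> ->.
Qed.

Lemma cconj_is_linear : linear cconj.
Proof.
move=> k [[x0 x1 x2 x3] [x4 x5 x6 x7]].
move=> [[y0 y1 y2 y3] [y4 y5 y6 y7]].
apply: cayley_ext; rewrite /=; ring.
Qed.
HB.instance Definition _ :=
  GRing.isLinear.Build K (cayley K) (cayley K) _ cconj cconj_is_linear.

Lemma cre_is_linear : scalar cre.
Proof. by []. Qed.
HB.instance Definition _ :=
  GRing.isLinear.Build K (cayley K) K *%R cre cre_is_linear.

Lemma cconjK : involutive cconj.
Proof.
by move=> [[x0 x1 x2 x3] [x4 x5 x6 x7]]; apply: cayley_ext; rewrite /= ?opprK.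
Qed.

Lemma cconj_one : cconj cone = cone.
Proof. by apply: cayley_ext; rewrite /= ?oppr0. Qed.

Lemma cmulDl_linear y : linear (cmul^~ y).
Proof.
move=> k [[x0 x1 x2 x3] [x4 x5 x6 x7]].
move=> [[z0 z1 z2 z3] [z4 z5 z6 z7]].
move: y => [[y0 y1 y2 y3] [y4 y5 y6 y7]].
apply: cayley_ext; rewrite /=; ring.
Qed.

Lemma cconj_mul x y : cconj (cmul x y) = cmul (cconj y) (cconj x).
Proof.
move: x => [[x0 x1 x2 x3] [x4 x5 x6 x7]].
move: y => [[y0 y1 y2 y3] [y4 y5 y6 y7]].
apply: cayley_ext; rewrite /=; ring.
Qed.

Lemma cmulDr_linear x : linear (cmul x).
Proof.
move=> k y z; rewrite -[LHS]cconjK cconj_mul linearP cmulDl_linear linearP /=.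
by rewrite !cconj_mul !cconjK.
Qed.

End Cayley.

Section CayleyMatrices.
Variable K : fieldType.

(* The library scales a matrix only by elements of its coefficient ring, whence
   this copy of the type. *)
Definition mat3 : Type := 'M[cayley K]_3.
HB.instance Definition _ := GRing.Zmodule.on mat3.

Definition mscale (k : K) (A : mat3) : mat3 := map_mx ( *:%R k) A.

Let mscaleA k l A : mscale k (mscale l A) = mscale (k * l) A.
Proof. by apply/matrixP => i j; rewrite !mxE scalerA. Qed.

Let mscale1 : left_id 1 mscale.
Proof. by move=> A; apply/matrixP => i j; rewrite !mxE scale1r. Qed.

Let mscaleDr : right_distributive mscale +%R.
Proof. by move=> k A B; apply/matrixP => i j; rewrite !mxE scalerDr. Qed.

Let mscaleDl A : {morph mscale^~ A : k l / k + l}.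
Proof. by move=> k l; apply/matrixP => i j; rewrite !mxE scalerDl. Qed.

HB.instance Definition _ :=
  GRing.Zmodule_isLmodule.Build K mat3 mscaleA mscale1 mscaleDr mscaleDl.

Lemma mscaleE k (A : mat3) i j : (k *: A) i j = k *: A i j.
Proof. exact: mxE. Qed.

Definition mmul (A B : mat3) : mat3 :=
  \matrix_(i, j) \sum_k cmul (A i k) (B k j).

Definition madj (A : mat3) : mat3 := \matrix_(i, j) cconj (A j i).

Lemma madj_is_linear : linear madj.
Proof.
by move=> k A B; apply/matrixP => i j; rewrite !(mscaleE, mxE) linearP.
Qed.
HB.instance Definition _ := GRing.isLinear.Build K mat3 mat3 _ madj madj_is_linear.

Lemma mmulDl_linear B : linear (mmul^~ B).
Proof.
move=> k A A'; apply/matrixP => i j; rewrite !(mscaleE, mxE).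
rewrite scaler_sumr -big_split; apply: eq_bigr => l _ /=.
by rewrite !(mscaleE, mxE) cmulDl_linear.
Qed.

Lemma mmulDr_linear A : linear (mmul A).
Proof.
move=> k B B'; apply/matrixP => i j; rewrite !(mscaleE, mxE).
rewrite scaler_sumr -big_split; apply: eq_bigr => l _ /=.
by rewrite !(mscaleE, mxE) cmulDr_linear.
Qed.

Lemma madj_mul A B : madj (mmul A B) = mmul (madj B) (madj A).
Proof.
apply/matrixP => i j; rewrite !mxE linear_sum; apply: eq_bigr => l _ /=.
by rewrite cconj_mul !mxE.
Qed.

End CayleyMatrices.

Section Jordan.
Variable K : fieldType.

Definition hermitian : pred (mat3 K) := fun A => madj A == A.

Record jordan : Type := Jordan { jmat :> mat3 K; jmatP : hermitian jmat }.
HB.instance Definition _ := [isSub for jmat].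
HB.instance Definition _ := [Choice of jordan by <:].

Let hermitian_submod : subsemimod_closed hermitian.
Proof.
split; first split.
- by apply/eqP; rewrite linear0.
- by move=> A B /eqP hA /eqP hB; apply/eqP; rewrite linearD /= hA hB.
- by move=> k A /eqP hA; apply/eqP; rewrite linearZ /= hA.
Qed.
HB.instance Definition _ :=
  GRing.SubChoice_isSubLmodule.Build K (mat3 K) hermitian jordan hermitian_submod.

Lemma jordan_ext (X Y : jordan) :
  (forall i j, jmat X i j = jmat Y i j) -> X = Y.
Proof. by move=> XY; apply/val_inj/matrixP. Qed.

Lemma jmatD (X Y : jordan) i j : jmat (X + Y) i j = jmat X i j + jmat Y i j.
Proof. by rewrite [jmat _](raddfD val) mxE. Qed.

Lemma jmatN (X : jordan) i j : jmat (- X) i j = - jmat X i j.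
Proof. by rewrite [jmat _](raddfN val) mxE. Qed.

Lemma jmatZ k (X : jordan) i j : jmat (k *: X) i j = k *: jmat X i j.
Proof. by rewrite [jmat _](linearZ_LR val) mscaleE. Qed.

Definition jmul_mat (X Y : mat3 K) : mat3 K := 2^-1 *: (mmul X Y + mmul Y X).

Let jmul_subproof (X Y : jordan) : hermitian (jmul_mat X Y).
Proof.
rewrite /hermitian linearZ linearD /= !madj_mul.
by rewrite !(eqP (jmatP _)) addrC.
Qed.

Definition jmul (X Y : jordan) : jordan := Jordan (jmul_subproof X Y).

(* The diagonal entries of a Hermitian matrix are their own conjugates, that
   is, scalar multiples of 1. *)
Definition jtr (X : jordan) : K := \sum_i cre (jmat X i i).

Definition jinner (X Y : jordan) : K := jtr (jmul X Y).

Definition diag_mat (d : 'I_3 -> K) : mat3 K :=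
  \matrix_(i, j) (if i == j then d i *: cone K else 0).

Let diag_subproof d : hermitian (diag_mat d).
Proof.
apply/eqP/matrixP => i j; rewrite !mxE eq_sym.
by case: eqP => [->|_]; rewrite ?linear0 // linearZ -[in RHS]cconj_one.
Qed.

Definition jdiag (d : 'I_3 -> K) : jordan := Jordan (diag_subproof d).

Definition jE : jordan := jdiag (fun=> 1).
Definition jE1 : jordan := jdiag (fun i => (i == 0)%:R).

(* The Freudenthal product X x Y. *)
Definition jcross (X Y : jordan) : jordan :=
  2^-1 *: (2 *: jmul X Y - jtr X *: Y - jtr Y *: X
           + (jtr X * jtr Y - jinner X Y) *: jE).

Definition jdet (X : jordan) : K := 3^-1 * jinner X (jcross X X).

Definition weight_mat (w : 'I_3 -> 'I_3 -> K) (X : mat3 K) : mat3 K :=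
  \matrix_(i, j) (w i j *: X i j).

Let weight_subproof (w : 'I_3 -> 'I_3 -> K) (X : jordan) :
  (forall i j, w i j = w j i) -> hermitian (weight_mat w X).
Proof.
move=> wC; apply/eqP/matrixP => i j; rewrite !mxE linearZ /= wC.
by rewrite -{2}(eqP (jmatP X)) mxE.
Qed.

Definition phi_weight (t : K) (i j : 'I_3) : K :=
  match i == 0, j == 0 with
  | true, true => t ^+ 4
  | false, false => t ^- 2
  | _, _ => t
  end.

Let phi_weightC t i j : phi_weight t i j = phi_weight t j i.
Proof. by rewrite /phi_weight; do 2 case: eqP. Qed.

(* The positions (0, 1), (1, 0) carry x_3 and its conjugate, and (2, 0), (0, 2)
   carry x_2 and its conjugate. *)
Definition phi (t : K) (X : jordan) : jordan :=
  Jordan (weight_subproof X (phi_weightC t)).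

Definition sigma_weight (i j : 'I_3) : K :=
  if (i == 0) == (j == 0) then 1 else -1.

Let sigma_weightC i j : sigma_weight i j = sigma_weight j i.
Proof. by rewrite /sigma_weight eq_sym. Qed.

Definition sigma (X : jordan) : jordan :=
  Jordan (weight_subproof X sigma_weightC).

Lemma jmulDl_linear Y : linear (jmul^~ Y).
Proof.
move=> k X X'; apply: val_inj; rewrite linearP /= /jmul_mat.
rewrite mmulDl_linear mmulDr_linear addrACA -scalerDr.
by rewrite [LHS]scalerDr !scalerA [k * _]mulrC.
Qed.

Lemma jmulC : commutative jmul.
Proof. by move=> X Y; apply: val_inj; rewrite /= /jmul_mat addrC. Qed.

Lemma jmulDr_linear X : linear (jmul X).
Proof. by move=> k Y Y'; rewrite jmulC jmulDl_linear !(jmulC X). Qed.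

Lemma jtr_is_linear : scalar jtr.
Proof.
move=> k X Y; rewrite /jtr mulr_sumr -big_split; apply: eq_bigr => i _.
by rewrite jmatD jmatZ linearP.
Qed.
HB.instance Definition _ :=
  GRing.isLinear.Build K jordan K *%R jtr jtr_is_linear.

End Jordan.

Arguments jE {K}.
Arguments jE1 {K}.

Section ChangeOfScalars.
Variables (K L : fieldType).

Section Additive.
Variable f : {additive K -> L}.

Definition qmap (a : quat K) : quat L :=
  Quat (f (q0 a)) (f (q1 a)) (f (q2 a)) (f (q3 a)).

Definition cmap (x : cayley K) : cayley L :=
  Cayley (qmap (cm x)) (qmap (ca x)).

Lemma cmap_conj x : cmap (cconj x) = cconj (cmap x).
Proof.
move: x => [[x0 x1 x2 x3] [x4 x5 x6 x7]].
by apply: cayley_ext; rewrite /= ?raddfN.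
Qed.

Lemma cmapD x y : cmap (x + y) = cmap x + cmap y.
Proof.
move: x y => [[x0 x1 x2 x3] [x4 x5 x6 x7]].
move=> [[y0 y1 y2 y3] [y4 y5 y6 y7]].
by apply: cayley_ext; rewrite /= ?raddfD.
Qed.

Lemma cmap0 : cmap 0 = 0.
Proof. by apply: cayley_ext; rewrite /= ?raddf0. Qed.

Let jmap_subproof (X : jordan K) :
  hermitian (map_mx cmap (X : mat3 K) : mat3 L).
Proof.
apply/eqP/matrixP => i j; rewrite !mxE -cmap_conj.
by rewrite -{2}(eqP (jmatP X)) mxE.
Qed.

Definition jmap (X : jordan K) : jordan L := Jordan (jmap_subproof X).

Lemma jmapE X i j : jmat (jmap X) i j = cmap (jmat X i j).
Proof. exact: mxE. Qed.

End Additive.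

Variable f : {rmorphism K -> L}.

Lemma cmapZ k x : cmap f (k *: x) = f k *: cmap f x.
Proof.
move: x => [[x0 x1 x2 x3] [x4 x5 x6 x7]].
by apply: cayley_ext; apply: rmorphM.
Qed.

Lemma cmapM x y : cmap f (cmul x y) = cmul (cmap f x) (cmap f y).
Proof.
move: x y => [[x0 x1 x2 x3] [x4 x5 x6 x7]].
move=> [[y0 y1 y2 y3] [y4 y5 y6 y7]].
by apply: cayley_ext;
  rewrite /= !(rmorphB, rmorphD, rmorphN, rmorphM).
Qed.

Lemma jmap_mul X Y : jmap f (jmul X Y) = jmul (jmap f X) (jmap f Y).
Proof.
apply/val_inj/matrixP => i j.
rewrite !(mscaleE, mxE) cmapZ cmapD fmorphV rmorph_nat.
congr (_ *: (_ + _)); rewrite (big_morph _ (cmapD f) (cmap0 f));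
by apply: eq_bigr => l _; rewrite cmapM !mxE.
Qed.

Lemma jmap_tr X : jtr (jmap f X) = f (jtr X).
Proof.
rewrite /jtr rmorph_sum; apply: eq_bigr => i _; rewrite mxE.
by [].
Qed.

End ChangeOfScalars.

Section Complexification.
Variable R : rcfType.
Local Notation C := R[i].

Definition jreal : jordan R -> jordan C := jmap (real_complex R).

(* tau (X1 + i X2) = X1 - i X2; see [jtauE]. *)
Definition jtau : jordan C -> jordan C := jmap (@conjc R).

Definition jherm (X Y : jordan C) : C := jinner (jtau X) Y.

Let joinC (x y : cayley R) : cayley C :=
  cmap (real_complex R) x + 'i *: cmap (real_complex R) y.

Let Re_additive : zmod_morphism (@complex.Re R).
Proof. by move=> [a b] [c d]. Qed.
HB.instance Definition _ := GRing.isZmodMorphism.Build C R _ Re_additive.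

Let Im_additive : zmod_morphism (@complex.Im R).
Proof. by move=> [a b] [c d]. Qed.
HB.instance Definition _ := GRing.isZmodMorphism.Build C R _ Im_additive.

Let Re_joinE (a b : R) : complex.Re (a%:C + ('i * b%:C))%C = a.
Proof. by rewrite /= mul0r mul1r oppr0 !addr0. Qed.

Let Im_joinE (a b : R) : complex.Im (a%:C + ('i * b%:C))%C = b.
Proof. by rewrite /= mul0r mul1r !add0r. Qed.

Let conj_joinE (a b : R) : conjc (a%:C + 'i * b%:C)%C = (a%:C - 'i * b%:C)%C.
Proof. by simpc. Qed.

Let conjE (x y : cayley R) :
  cmap (@conjc R) (joinC x y)
  = cmap (real_complex R) x - 'i *: cmap (real_complex R) y.
Proof.
rewrite /joinC -complexiE.
move: x y => [[x0 x1 x2 x3] [x4 x5 x6 x7]].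
move=> [[y0 y1 y2 y3] [y4 y5 y6 y7]].
by apply: cayley_ext; apply: conj_joinE.
Qed.

Let ReE (x y : cayley R) : cmap (@complex.Re R) (joinC x y) = x.
Proof.
rewrite /joinC -complexiE.
move: x y => [[x0 x1 x2 x3] [x4 x5 x6 x7]].
move=> [[y0 y1 y2 y3] [y4 y5 y6 y7]].
by apply: cayley_ext; apply: Re_joinE.
Qed.

Let ImE (x y : cayley R) : cmap (@complex.Im R) (joinC x y) = y.
Proof.
rewrite /joinC -complexiE.
move: x y => [[x0 x1 x2 x3] [x4 x5 x6 x7]].
move=> [[y0 y1 y2 y3] [y4 y5 y6 y7]].
by apply: cayley_ext; apply: Im_joinE.
Qed.

Let joinE (x : cayley C) :
  x = joinC (cmap (@complex.Re R) x) (cmap (@complex.Im R) x).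
Proof.
rewrite /joinC -complexiE.
move: x => [[x0 x1 x2 x3] [x4 x5 x6 x7]].
by apply: cayley_ext; apply: complexE.
Qed.

Let jjoinE (X1 X2 : jordan R) i j :
  jmat (jreal X1 + 'i *: jreal X2) i j = joinC (jmat X1 i j) (jmat X2 i j).
Proof. by rewrite jmatD jmatZ !jmapE. Qed.

Lemma jordan_complexification (X : jordan C) :
  exists! X12 : jordan R * jordan R, X = jreal X12.1 + 'i *: jreal X12.2.
Proof.
exists (jmap (@complex.Re R) X, jmap (@complex.Im R) X).
split=> [|[X1 X2] /= ->].
  by apply: jordan_ext => i j; rewrite jjoinE !jmapE -joinE.
by congr (_, _); apply: jordan_ext => i j; rewrite jmapE jjoinE ?ReE ?ImE.
Qed.

Lemma jtauE (X1 X2 : jordan R) :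
  jtau (jreal X1 + 'i *: jreal X2) = jreal X1 - 'i *: jreal X2.
Proof.
apply: jordan_ext => i j; rewrite /jtau jmapE (jjoinE X1 X2) conjE.
by rewrite jmatD jmatN jmatZ !jmapE.
Qed.

End Complexification.

Local Open Scope group_scope.

Section QuotientGroup.
Variable G : groupType.

Record normal_subgroup (N : set G) : Prop := NormalSubgroup {
  normal1 : N 1;
  normalM : forall x y, N x -> N y -> N (x * y);
  normalV : forall x, N x -> N x^-1;
  normalJ : forall g x, N x -> N (x ^ g)
}.

Definition coset (N : set G) (g : G) : set G := [set g * n | n in N].

(* The left cosets of N, multiplied as subsets of G. The proof nN is a parameter
   of the type because the group structure depends on it. *)
Record quotient_group (N : set G) (nN : normal_subgroup N) : Type := InQuotient {
  coset_set :> set G;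
  coset_setP : `[< exists g, coset_set = coset N g >]
}.

Variables (N : set G) (nN : normal_subgroup N).
Local Notation quotient := (quotient_group nN).

HB.instance Definition _ := [isSub for @coset_set N nN].
HB.instance Definition _ := [Choice of quotient by <:].

Lemma coset_mem g h : coset N g h <-> N (g^-1 * h).
Proof.
split=> [[n Nn <-]|Nh]; first by rewrite mulKg.
by exists (g^-1 * h); rewrite // mulVKg.
Qed.

Let coset_mul g h :
  [set x * y | x in coset N g & y in coset N h] = coset N (g * h).
Proof.
apply/seteqP; split=> z.
  move=> [_ [m Nm <-] [_ [n Nn <-] <-]].
  exists (m ^ h * n); first by apply: (normalM nN) => //; exact: normalJ.
  by rewrite /conjg !mulgA mulgK.
move=> [n Nn <-]; exists g; first by exists 1; rewrite ?mulg1 //; apply: normal1.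
by exists (h * n); [exists n | rewrite mulgA].
Qed.

Let coset_inv g : [set x^-1 | x in coset N g] = coset N g^-1.
Proof.
apply/seteqP; split=> z.
  move=> [_ [n Nn <-] <-]; exists (n^-1 ^ g^-1).
    by apply: normalJ => //; apply: normalV.
  by rewrite /conjg invgK invgM mulKg.
move=> [n Nn <-]; exists ((g^-1 * n)^-1); last by rewrite invgK.
apply/coset_mem; rewrite invgM invgK.
have -> : g^-1 * (n^-1 * g) = n^-1 ^ g by [].
by apply: normalJ => //; apply: normalV.
Qed.

Let mul_subproof (A B : quotient) :
  `[< exists g, [set x * y | x in A & y in B] = coset N g >].
Proof.
apply/asboolP; case: (asboolW (coset_setP A)) (asboolW (coset_setP B)) => g -> [h ->].
by exists (g * h); rewrite coset_mul.
Qed.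

Let inv_subproof (A : quotient) :
  `[< exists g, [set x^-1 | x in A] = coset N g >].
Proof.
apply/asboolP; case: (asboolW (coset_setP A)) => g ->.
by exists g^-1; rewrite coset_inv.
Qed.

Let one_subproof : `[< exists g, N = coset N g >].
Proof.
apply/asboolP; exists 1; apply/seteqP; split=> x.
  by move=> Nx; exists x; rewrite ?mul1g.
by move=> [n Nn <-]; rewrite mul1g.
Qed.

Definition quotient_mul (A B : quotient) : quotient := InQuotient nN (mul_subproof A B).
Definition quotient_inv (A : quotient) : quotient := InQuotient nN (inv_subproof A).
Definition quotient_one : quotient := InQuotient nN one_subproof.

Let coset1 : N = coset N 1.
Proof.
apply/seteqP; split=> x.
  by move=> Nx; exists x; rewrite ?mul1g.
by move=> [n Nn <-]; rewrite mul1g.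
Qed.

Let quotient_mulA : associative quotient_mul.
Proof.
move=> [A PA] [B PB] [D PD]; apply: val_inj => /=.
move: (asboolW PA) (asboolW PB) (asboolW PD) => [a ->] [b ->] [d ->].
by rewrite !coset_mul mulgA.
Qed.

Let quotient_mul1 : left_id quotient_one quotient_mul.
Proof.
move=> [A PA]; apply: val_inj => /=; move: (asboolW PA) => [a ->].
by rewrite {1}coset1 coset_mul mul1g.
Qed.

Let quotient_mulr1 : right_id quotient_one quotient_mul.
Proof.
move=> [A PA]; apply: val_inj => /=; move: (asboolW PA) => [a ->].
by rewrite {2}coset1 coset_mul mulg1.
Qed.

Let quotient_mulV : left_inverse quotient_one quotient_inv quotient_mul.
Proof.
move=> [A PA]; apply: val_inj => /=; move: (asboolW PA) => [a ->].
by rewrite coset_inv coset_mul mulVg -coset1.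
Qed.

Let quotient_mulrV : right_inverse quotient_one quotient_inv quotient_mul.
Proof.
move=> [A PA]; apply: val_inj => /=; move: (asboolW PA) => [a ->].
by rewrite coset_inv coset_mul mulgV -coset1.
Qed.

HB.instance Definition _ := isGroup.Build quotient
  quotient_mulA quotient_mul1 quotient_mulr1 quotient_mulV quotient_mulrV.

End QuotientGroup.

Definition isomorphic (G H : groupType) : Prop :=
  exists f : {multiplicative G -> H}, bijective f.

Section LinearAutomorphisms.
Variables (K : fieldType) (V : lmodType K).

Record lin_aut : Type := LinAut {
  aut_fun :> V -> V;
  autP : `[< linear aut_fun /\ bijective aut_fun >]
}.
HB.instance Definition _ := [isSub for aut_fun].
HB.instance Definition _ := [Choice of lin_aut by <:].

Let one_subproof : `[< linear (@id V) /\ bijective (@id V) >].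
Proof. by apply/asboolP; split=> //; exists id. Qed.

Let mul_subproof (a b : lin_aut) :
  `[< linear (a \o b) /\ bijective (a \o b) >].
Proof.
have [la ba] := asboolW (autP a); have [lb bb] := asboolW (autP b).
by apply/asboolP; split; [move=> k x y /=; rewrite lb la | exact: bij_comp].
Qed.

Let inv_ex (a : lin_aut) : {b : V -> V | cancel a b /\ cancel b a}.
Proof.
by apply: cid; have [_ [b ab ba]] := asboolW (autP a); exists b.
Qed.

Let inv_subproof (a : lin_aut) :
  `[< linear (sval (inv_ex a)) /\ bijective (sval (inv_ex a)) >].
Proof.
case: (inv_ex a) => b [ab ba] /=; apply/asboolP.
have [la _] := asboolW (autP a); split; last by exists a.
by move=> k x y; apply: (can_inj ab); rewrite la !ba.
Qed.

Definition aut_one : lin_aut := LinAut one_subproof.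
Definition aut_mul (a b : lin_aut) : lin_aut := LinAut (mul_subproof a b).
Definition aut_inv (a : lin_aut) : lin_aut := LinAut (inv_subproof a).

Let aut_mulA : associative aut_mul.
Proof. by move=> a b c; apply: val_inj. Qed.

Let aut_mul1 : left_id aut_one aut_mul.
Proof. by move=> a; apply: val_inj. Qed.

Let aut_mulr1 : right_id aut_one aut_mul.
Proof. by move=> a; apply: val_inj. Qed.

Let aut_mulV : left_inverse aut_one aut_inv aut_mul.
Proof.
move=> a; apply/val_inj/funext => x /=.
by case: (inv_ex a) => b [/= ab _]; rewrite ab.
Qed.

Let aut_mulrV : right_inverse aut_one aut_inv aut_mul.
Proof.
move=> a; apply/val_inj/funext => x /=.
by case: (inv_ex a) => b [/= _ ba]; rewrite ba.
Qed.

HB.instance Definition _ := isGroup.Build lin_aut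
  aut_mulA aut_mul1 aut_mulr1 aut_mulV aut_mulrV.

Lemma aut_mulE (a b : lin_aut) x : (a * b) x = a (b x).
Proof. by []. Qed.

Lemma aut_oneE x : (1 : lin_aut) x = x.
Proof. by []. Qed.

Lemma aut_invK (a : lin_aut) : cancel a a^-1.
Proof. by move=> x; rewrite -aut_mulE mulVg. Qed.

Lemma aut_invVK (a : lin_aut) : cancel a^-1 a.
Proof. by move=> x; rewrite -aut_mulE mulgV. Qed.

End LinearAutomorphisms.

Section Groups.
Variable R : realType.
Local Notation C := R[i].

Record U1 : Type := UnitComplex { u1_val :> C; u1P : `|u1_val| == 1%R }.
HB.instance Definition _ := [isSub for u1_val].
HB.instance Definition _ := [Choice of U1 by <:].

Let u1_one_subproof : `|1%R : C| == 1%R.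
Proof. by rewrite normr1. Qed.

Let u1_mul_subproof (s t : U1) : `|(s : C) * t|%R == 1%R.
Proof. by rewrite normrM !(eqP (u1P _)) mulr1. Qed.

Let u1_inv_subproof (t : U1) : `|(t : C)^-1|%R == 1%R.
Proof. by rewrite normfV (eqP (u1P t)) invr1. Qed.

Definition u1_one : U1 := UnitComplex u1_one_subproof.
Definition u1_mul (s t : U1) : U1 := UnitComplex (u1_mul_subproof s t).
Definition u1_inv (t : U1) : U1 := UnitComplex (u1_inv_subproof t).

Let u1_neq0 (t : U1) : (t : C) != 0%R.
Proof. by rewrite -normr_eq0 (eqP (u1P t)) oner_eq0. Qed.

Let u1_mulA : associative u1_mul.
Proof. by move=> r s t; apply/val_inj/mulrA. Qed.

Let u1_mul1 : left_id u1_one u1_mul.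
Proof. by move=> t; apply/val_inj/mul1r. Qed.

Let u1_mulr1 : right_id u1_one u1_mul.
Proof. by move=> t; apply/val_inj/mulr1. Qed.

Let u1_mulV : left_inverse u1_one u1_inv u1_mul.
Proof. by move=> t; apply/val_inj/mulVf/u1_neq0. Qed.

Let u1_mulrV : right_inverse u1_one u1_inv u1_mul.
Proof. by move=> t; apply/val_inj/mulfV/u1_neq0. Qed.

HB.instance Definition _ := isGroup.Build U1
  u1_mulA u1_mul1 u1_mulr1 u1_mulV u1_mulrV.

Local Notation JC := (jordan C).

Definition in_E6 : pred (lin_aut JC) := fun a =>
  `[< (forall X, jdet (a X) = jdet X) /\
      (forall X Y, jherm (a X) (a Y) = jherm X Y) >].

Record E6 : Type := InE6 { e6_val :> lin_aut JC; e6P : in_E6 e6_val }.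
HB.instance Definition _ := [isSub for e6_val].
HB.instance Definition _ := [Choice of E6 by <:].

Let E6_closed : group_closed in_E6.
Proof.
split=> [|a b /asboolW[da ha] /asboolW[db hb]]; apply/asboolT; split.
- by move=> X; rewrite aut_oneE.
- by move=> X Y; rewrite !aut_oneE.
- by move=> X; rewrite aut_mulE da -[LHS]db aut_invVK.
- by move=> X Y; rewrite !aut_mulE ha -[LHS]hb !aut_invVK.
Qed.
HB.instance Definition _ :=
  SubChoice_isSubGroup.Build (lin_aut JC) in_E6 E6 E6_closed.

Definition in_E6_sigma : pred E6 := fun a =>
  `[< forall X : JC, sigma (a X) = a (sigma X) >].

Record E6_sigma : Type := InE6Sigma { e6s_val :> E6; e6sP : in_E6_sigma e6s_val }.
HB.instance Definition _ := [isSub for e6s_val].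
HB.instance Definition _ := [Choice of E6_sigma by <:].

Lemma E6_mulE (a b : E6) (X : JC) : (a * b) X = a (b X).
Proof. by rewrite valM. Qed.

Lemma E6_invVK (a : E6) (X : JC) : a (a^-1 X) = X.
Proof. by rewrite -E6_mulE mulgV. Qed.

Lemma E6_invK (a : E6) (X : JC) : a^-1 (a X) = X.
Proof. by rewrite -E6_mulE mulVg. Qed.

Let E6_sigma_closed : group_closed in_E6_sigma.
Proof.
split=> [|a b /asboolP sa /asboolP sb]; apply/asboolP => X //.
by rewrite !E6_mulE sa -{2}(E6_invVK b X) sb E6_invK.
Qed.
HB.instance Definition _ :=
  SubChoice_isSubGroup.Build E6 in_E6_sigma E6_sigma E6_sigma_closed.

Definition fixes_E1 : pred E6 := fun a => a jE1 == jE1 :> JC.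

(* Spin(10) is realized as the stabilizer of E_1 in E_6. *)
Record Spin10 : Type := InSpin10 { spin10_val :> E6; spin10P : fixes_E1 spin10_val }.
HB.instance Definition _ := [isSub for spin10_val].
HB.instance Definition _ := [Choice of Spin10 by <:].

Let Spin10_closed : group_closed fixes_E1.
Proof.
split=> [|a b /eqP fa /eqP fb]; apply/eqP => //.
by rewrite E6_mulE -{1}fb E6_invK.
Qed.
HB.instance Definition _ :=
  SubChoice_isSubGroup.Build E6 fixes_E1 Spin10 Spin10_closed.

(* {(1, phi 1), (-1, phi (-1)), (i, phi (-i)), (-i, phi i)}, where a pair of
   U1 * Spin10 is compared with these through its underlying complex number and
   its underlying map. *)
Definition Z4 : set (U1 * Spin10) :=
  [set p : U1 * Spin10 |
    [\/ (p.1 : C) = 1%R /\ p.2 =1 phi 1%R,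
        (p.1 : C) = (-1)%R /\ p.2 =1 phi (-1)%R,
        (p.1 : C) = 'i%R /\ p.2 =1 phi (- 'i)%R |
        (p.1 : C) = (- 'i)%R /\ p.2 =1 phi 'i%R]].

End Groups.

(* Main.v *)
From HB Require Import structures.
Require Import Defs.
From mathcomp Require Import all_boot all_order all_algebra reals.
From mathcomp Require Import complex ring boolp classical_sets.

(** The map (t, d) |-> phi t * d is a surjective morphism from
    U(1) x (E6)_{E1} onto the centralizer of sigma, with kernel Z4; the first
    isomorphism theorem ([first_isomorphism]) then gives the result. Everything
    rests on the Peirce decomposition of the Jordan algebra with respect to the
    idempotent E1: the line of E1, the half space (the entries x2, x3) and the
    zero space (the entries xi 1, xi 2, x1). On these three spaces phi t
    is the scalar t^4, t and t^-2, and sigma is phi (-1) ([sigmaE]). So the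
    elements phi t commute with any map that preserves the three spaces.

    The morphism property: an element d of E6 fixing E1 preserves the quadratic
    form det (E1 + X) - det X = (xi 1)(xi 2) - x1 conj(x1), hence its radical, which
    is spanned by E1 and the half space. The Hermitian form then singles out the
    half space (the part of the radical orthogonal to E1) and the zero space
    (the orthogonal of the radical), so d preserves all three spaces and
    commutes with every phi t ([stab_phi]), in particular with sigma.

    Surjectivity: let a commute with sigma. It preserves the half space, which
    is the (-1)-eigenspace of sigma, and a E1 is fixed by sigma. As
    det (E1 + W) = 0 for every W in the half space, also det (a E1 + W) = 0 for
    every such W; evaluating at simple W shows that only the first coordinate of
    a E1 is nonzero ([E1_characterization]). So a E1 = y E1, with |y| = 1
    because a is unitary, and phi t^-1 * a fixes E1 for any fourth root t of y.

    Kernel: if phi t * d = 1 then evaluation at E1 gives t^4 = 1, and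
    d = phi t^-1.

    The computational input is the explicit cubic form of the determinant in the
    six coordinates ([jdetE]). *)

Set Implicit Arguments.
Unset Strict Implicit.
Unset Printing Implicit Defensive.

Import Order.TTheory GRing.Theory Num.Theory.

Local Open Scope ring_scope.

(** * The first isomorphism theorem *)

Section FirstIsomorphism.
Local Open Scope group_scope.
Variables (G H : groupType) (f : G -> H) (N : set G).
Hypotheses (fM : {morph f : x y / x * y}) (fN : forall g, N g <-> f g = 1).

Let f1 : f 1 = 1.
Proof. by apply: (mulgI (f 1)); rewrite -fM !mulg1. Qed.

Let fV g : f g^-1 = (f g)^-1.
Proof. by apply: (mulgI (f g)); rewrite -fM !mulgV. Qed.

Lemma kernel_normal : normal_subgroup N.
Proof.
split=> [|x y /fN fx /fN fy|x /fN fx|g x /fN fx]; apply/fN => //.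
- by rewrite fM fx fy mulg1.
- by rewrite fV fx invg1.
- by rewrite /conjg !fM fx fV mul1g mulVg.
Qed.

Lemma coset_fiber g h : coset N g h <-> f h = f g.
Proof.
split=> [/coset_mem/fN|fhg]; last by apply/coset_mem/fN; rewrite fM fV fhg mulVg.
by rewrite fM fV => fgh; rewrite -[f h](mulVKg (f g)) fgh mulg1.
Qed.

Lemma eq_coset g h : coset N g = coset N h <-> f g = f h.
Proof.
split=> [gh|fgh]; first by apply/coset_fiber; rewrite -gh; apply/coset_fiber.
by apply/seteqP; split=> x /coset_fiber fx; apply/coset_fiber; rewrite fx fgh.
Qed.

(** The isomorphism goes from the image to the quotient: it sends h to the coset
    of a chosen preimage of h, which is the whole fibre of f over h. *)
Lemma first_isomorphism (nN : normal_subgroup N) :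
  (forall h, exists g, f g = h) -> isomorphic H (quotient_group nN).
Proof.
move=> f_onto; pose s h := sval (cid (f_onto h)).
have fs h : f (s h) = h by rewrite /s; case: cid.
pose F h : quotient_group nN := InQuotient nN (asboolT (ex_intro _ (s h) erefl)).
have FM : {morph F : x y / x * y}.
  move=> x y; apply/val_inj => /=; apply/seteqP; split=> z.
    move=> /coset_fiber; rewrite fs => fz; exists (s x); first exact/coset_fiber.
    exists ((s x)^-1 * z); last by rewrite mulVKg.
    by apply/coset_fiber; rewrite fM fV fz !fs mulKg.
  move=> [a /coset_fiber fa [b /coset_fiber fb <-]].
  by apply/coset_fiber; rewrite fM fa fb !fs.
pose F_mult := isMultiplicative.Build H (quotient_group nN) F FM.
pose F_hom : {multiplicative H -> quotient_group nN} := HB.pack F F_mult.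
exists F_hom; rewrite /= -/F.
exists (fun A => f (sval (cid (asboolW (coset_setP A))))) => [h|A];
  case: cid => g /= Ag.
  by have /eq_coset := Ag; rewrite fs.
by apply: val_inj; rewrite /= Ag; apply/eq_coset; rewrite fs.
Qed.

End FirstIsomorphism.

(** * The bilinear and trilinear forms of the Cayley algebra *)

Section CayleyForms.
Variable K : fieldType.
Implicit Types x y z : cayley K.

Definition cdot x y : K := cre (cmul x (cconj y)).

Lemma cdotE x y : cdot x y =
  q0 (cm x) * q0 (cm y) + q1 (cm x) * q1 (cm y)
  + q2 (cm x) * q2 (cm y) + q3 (cm x) * q3 (cm y)
  + (q0 (ca x) * q0 (ca y) + q1 (ca x) * q1 (ca y)
  + q2 (ca x) * q2 (ca y) + q3 (ca x) * q3 (ca y)).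
Proof.
move: x y => [[a0 a1 a2 a3] [a4 a5 a6 a7]] [[b0 b1 b2 b3] [b4 b5 b6 b7]].
by rewrite /cdot /cre /=; ring.
Qed.

Lemma cdotC x y : cdot x y = cdot y x.
Proof. by rewrite !cdotE; ring. Qed.

Lemma cdot_linear x : scalar (cdot x).
Proof. by move=> k y z; rewrite !cdotE /=; ring. Qed.
HB.instance Definition _ x :=
  GRing.isLinear.Build K (cayley K) K *%R (cdot x) (cdot_linear x).

Lemma cdotZl k x y : cdot (k *: x) y = k * cdot x y.
Proof. by rewrite cdotC linearZ cdotC. Qed.

Lemma cdot_nondegenerate y : (forall x, cdot x y = 0) -> y = 0.
Proof.
move=> xy0; apply: cayley_ext => /=.
- by have := xy0 (Cayley (Quat 1 0 0 0) 0);
    rewrite cdotE /= !mul0r mul1r !addr0.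
- by have := xy0 (Cayley (Quat 0 1 0 0) 0);
    rewrite cdotE /= !mul0r mul1r !addr0 add0r.
- by have := xy0 (Cayley (Quat 0 0 1 0) 0);
    rewrite cdotE /= !mul0r mul1r !addr0 !add0r.
- by have := xy0 (Cayley (Quat 0 0 0 1) 0);
    rewrite cdotE /= !mul0r mul1r !addr0 !add0r.
- by have := xy0 (Cayley 0 (Quat 1 0 0 0));
    rewrite cdotE /= !mul0r mul1r !addr0 !add0r.
- by have := xy0 (Cayley 0 (Quat 0 1 0 0));
    rewrite cdotE /= !mul0r mul1r !addr0 !add0r.
- by have := xy0 (Cayley 0 (Quat 0 0 1 0));
    rewrite cdotE /= !mul0r mul1r !addr0 !add0r.
- by have := xy0 (Cayley 0 (Quat 0 0 0 1));
    rewrite cdotE /= !mul0r mul1r !addr0 !add0r.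
Qed.

Lemma cmulZl k x y : cmul (k *: x) y = k *: cmul x y.
Proof.
move: x y => [[a0 a1 a2 a3] [a4 a5 a6 a7]] [[b0 b1 b2 b3] [b4 b5 b6 b7]].
by apply: cayley_ext; rewrite /=; ring.
Qed.

Lemma cmulZr k x y : cmul x (k *: y) = k *: cmul x y.
Proof.
move: x y => [[a0 a1 a2 a3] [a4 a5 a6 a7]] [[b0 b1 b2 b3] [b4 b5 b6 b7]].
by apply: cayley_ext; rewrite /=; ring.
Qed.

Lemma cmul1 x : cmul (cone K) x = x.
Proof.
case: x => [[a0 a1 a2 a3] [a4 a5 a6 a7]].
by apply: cayley_ext; rewrite /=; ring.
Qed.

Lemma cmulr1 x : cmul x (cone K) = x.
Proof.
case: x => [[a0 a1 a2 a3] [a4 a5 a6 a7]].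
by apply: cayley_ext; rewrite /=; ring.
Qed.

Lemma cmul0 x : cmul 0 x = 0.
Proof. by rewrite -(scale0r 0) cmulZl !scale0r. Qed.

Lemma cmulr0 x : cmul x 0 = 0.
Proof. by rewrite -(scale0r 0) cmulZr !scale0r. Qed.

Definition ctriple x y z : K := cre (cmul (cmul x y) z).

(** The Cayley algebra is not associative, but associators have no real part. *)
Lemma cre_mulA x y z : cre (cmul (cmul x y) z) = cre (cmul x (cmul y z)).
Proof.
move: x y z => [[x0 x1 x2 x3] [x4 x5 x6 x7]] [[y0 y1 y2 y3] [y4 y5 y6 y7]].
case=> [[z0 z1 z2 z3] [z4 z5 z6 z7]].
by rewrite /cre /=; ring.
Qed.

Lemma cre_mulC x y : cre (cmul x y) = cre (cmul y x).
Proof.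
move: x y => [[a0 a1 a2 a3] [a4 a5 a6 a7]] [[b0 b1 b2 b3] [b4 b5 b6 b7]].
by rewrite /cre /=; ring.
Qed.

Lemma cdot_conj_mul x y z : cdot x (cconj (cmul y z)) = ctriple x y z.
Proof. by rewrite /cdot cconjK -cre_mulA. Qed.

Lemma ctriple_cycle x y z : ctriple x y z = ctriple y z x.
Proof. by rewrite /ctriple cre_mulA cre_mulC. Qed.

End CayleyForms.

(** * Coordinates on the Jordan algebra *)

Section Coordinates.
Variable K : fieldType.
Implicit Types (x y z : cayley K) (X Y Z : jordan K).
Hypothesis two_neq0 : 2 != 0 :> K.

Lemma ord3P (P : 'I_3 -> Prop) : P 0 -> P 1 -> P 2 -> forall i, P i.
Proof.
move=> P0 P1 P2 [[|[|[|//]]] lt_i3].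
- by rewrite (_ : Ordinal lt_i3 = 0) //; apply: val_inj.
- by rewrite (_ : Ordinal lt_i3 = 1) //; apply: val_inj.
- by rewrite (_ : Ordinal lt_i3 = 2) //; apply: val_inj.
Qed.

Lemma sum3 (V : nmodType) (F : 'I_3 -> V) : \sum_i F i = F 0 + F 1 + F 2.
Proof.
rewrite !big_ord_recl big_ord0 addr0 addrA.
by congr (_ + F _ + F _); apply: val_inj.
Qed.

(** The diagonal is numbered from 0, so that xi 0, xi 1, xi 2 are the usual
    xi_1, xi_2, xi_3. *)
Definition xi (i : 'I_3) X : K := cre (jmat X i i).
Definition x1 X : cayley K := jmat X 1 2.
Definition x2 X : cayley K := jmat X 2 0.
Definition x3 X : cayley K := jmat X 0 1.

Lemma jmat_conj X i j : jmat X i j = cconj (jmat X j i).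
Proof. by rewrite -[in LHS](eqP (jmatP X)) mxE. Qed.

Lemma jmat_diag X i : jmat X i i = xi i X *: cone K.
Proof.
have := jmat_conj X i i; rewrite /xi.
case: (jmat X i i) => [[a0 a1 a2 a3] [a4 a5 a6 a7]].
have N0 (a : K) : a = - a -> a = 0.
  by move=> aN; apply: (mulfI two_neq0); rewrite mulr0 mulr2n mulrDl mul1r {2}aN subrr.
case=> /N0-> /N0-> /N0-> /N0-> /N0-> /N0-> /N0->.
by apply: cayley_ext; rewrite /= ?mulr1 ?mulr0.
Qed.

Lemma coord_ext X Y : (forall i, xi i X = xi i Y) ->
  x1 X = x1 Y -> x2 X = x2 Y -> x3 X = x3 Y -> X = Y.
Proof.
move=> eq_d e1 e2 e3; apply: jordan_ext; elim/ord3P; elim/ord3P.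
1,5,9: by rewrite !jmat_diag eq_d.
all: try by [].
all: by rewrite jmat_conj [RHS]jmat_conj; congr cconj.
Qed.

Definition coord_mat (a b c : K) x y z : mat3 K := \matrix_(i, j)
  match val i, val j with
  | 0, 0 => a *: cone K | 0, 1 => z | 0, _ => cconj y
  | 1, 0 => cconj z | 1, 1 => b *: cone K | 1, _ => x
  | _, 0 => y | _, 1 => cconj x | _, _ => c *: cone K
  end%N.

Fact coord_mat_hermitian a b c x y z : Defs.hermitian (coord_mat a b c x y z).
Proof.
apply/eqP/matrixP; elim/ord3P; elim/ord3P; rewrite !mxE /= ?cconjK //.
all: by apply: cayley_ext; rewrite /= ?mulr0 ?oppr0.
Qed.

Definition of_coord a b c x y z := Jordan (coord_mat_hermitian a b c x y z).

Lemma of_coordE a b c x y z (X := of_coord a b c x y z) :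
  ((xi 0 X = a) * (xi 1 X = b) * (xi 2 X = c))
  * ((x1 X = x) * (x2 X = y) * (x3 X = z)).
Proof. by rewrite /xi /x1 /x2 /x3 !mxE /cre /= !mulr1. Qed.

Lemma coordD X Y : (forall i, xi i (X + Y) = xi i X + xi i Y) *
  (x1 (X + Y) = x1 X + x1 Y) * (x2 (X + Y) = x2 X + x2 Y) *
  (x3 (X + Y) = x3 X + x3 Y).
Proof.
by split; [split; [split => [i|]|]|]; rewrite /xi /x1 /x2 /x3 jmatD ?linearD.
Qed.

Lemma coordN X : (forall i, xi i (- X) = - xi i X) *
  (x1 (- X) = - x1 X) * (x2 (- X) = - x2 X) * (x3 (- X) = - x3 X).
Proof.
by split; [split; [split => [i|]|]|]; rewrite /xi /x1 /x2 /x3 jmatN ?linearN.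
Qed.

Lemma coordZ k X : (forall i, xi i (k *: X) = k * xi i X) *
  (x1 (k *: X) = k *: x1 X) * (x2 (k *: X) = k *: x2 X) *
  (x3 (k *: X) = k *: x3 X).
Proof.
by split; [split; [split => [i|]|]|]; rewrite /xi /x1 /x2 /x3 jmatZ ?linearZ_LR.
Qed.

Lemma coord_jdiag d : (forall i, xi i (jdiag d) = d i) *
  (x1 (jdiag d) = 0) * (x2 (jdiag d) = 0) * (x3 (jdiag d) = 0).
Proof.
split; [split; [split => [i|]|]|]; rewrite /xi /x1 /x2 /x3 mxE //.
by rewrite eqxx /cre /= mulr1.
Qed.

Lemma coord_E1 : (forall i, xi i (jE1 : jordan K) = (i == 0)%:R) *
  (x1 (jE1 : jordan K) = 0) * (x2 (jE1 : jordan K) = 0) *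
  (x3 (jE1 : jordan K) = 0).
Proof. exact: coord_jdiag. Qed.

Lemma jinnerE X Y : jinner X Y =
  xi 0 X * xi 0 Y + xi 1 X * xi 1 Y + xi 2 X * xi 2 Y
  + 2 * (cdot (x1 X) (x1 Y) + cdot (x2 X) (x2 Y) + cdot (x3 X) (x3 Y)).
Proof.
rewrite /jinner /jtr sum3 !(mxE, mscaleE) !sum3 /= !jmat_diag.
rewrite (jmat_conj X 1 0) (jmat_conj X 2 1) (jmat_conj X 0 2).
rewrite (jmat_conj Y 1 0) (jmat_conj Y 2 1) (jmat_conj Y 0 2).
rewrite -!/(x1 _) -!/(x2 _) -!/(x3 _).
move: (xi 0 X) (xi 1 X) (xi 2 X) (xi 0 Y) (xi 1 Y) (xi 2 Y) => a b c a' b' c'.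
case: (x1 X) => [[p0 p1 p2 p3] [p4 p5 p6 p7]].
case: (x1 Y) => [[q0 q1 q2 q3] [q4 q5 q6 q7]].
case: (x2 X) => [[r0 r1 r2 r3] [r4 r5 r6 r7]].
case: (x2 Y) => [[s0 s1 s2 s3] [s4 s5 s6 s7]].
case: (x3 X) => [[t0 t1 t2 t3] [t4 t5 t6 t7]].
case: (x3 Y) => [[u0 u1 u2 u3] [u4 u5 u6 u7]].
by rewrite !cdotE /cre /=; field.
Qed.

Lemma jmat_sqr X i j : jmat (jmul X X) i j =
  cmul (jmat X i 0) (jmat X 0 j) + cmul (jmat X i 1) (jmat X 1 j)
  + cmul (jmat X i 2) (jmat X 2 j).
Proof.
rewrite !(mxE, mscaleE) !sum3 -[X in X + X]scale1r -scalerDl scalerA mulVf //.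
by rewrite scale1r.
Qed.

Lemma cre_cmul_conj x y : cre (cmul (cconj x) y) = cdot x y.
Proof. by rewrite cre_mulC cdotC. Qed.

Lemma xi_sqr X :
  (xi 0 (jmul X X) = xi 0 X ^+ 2 + cdot (x3 X) (x3 X) + cdot (x2 X) (x2 X)) *
  (xi 1 (jmul X X) = cdot (x3 X) (x3 X) + xi 1 X ^+ 2 + cdot (x1 X) (x1 X)) *
  (xi 2 (jmul X X) = cdot (x2 X) (x2 X) + cdot (x1 X) (x1 X) + xi 2 X ^+ 2).
Proof.
rewrite /xi !jmat_sqr !jmat_diag.
rewrite (jmat_conj X 1 0) (jmat_conj X 0 2) (jmat_conj X 2 1).
rewrite -!/(x1 _) -!/(x2 _) -!/(x3 _) !cmulZl !cmul1.
have creD : {morph @cre K : x y / x + y} by [].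
have cre_scale k : cre (k *: cone K) = k by rewrite /cre /= mulr1.
by rewrite !creD !cre_cmul_conj -!/(cdot _ _) !scalerA !cre_scale -!expr2.
Qed.

Lemma x1_sqr X : x1 (jmul X X) =
  (xi 1 X + xi 2 X) *: x1 X + cconj (cmul (x2 X) (x3 X)).
Proof.
rewrite {1}/x1 jmat_sqr (jmat_conj X 0 2) (jmat_conj X 1 0) !jmat_diag.
by rewrite cmulZl cmul1 cmulZr cmulr1 cconj_mul scalerDl -addrA addrC.
Qed.

Lemma x2_sqr X : x2 (jmul X X) =
  (xi 2 X + xi 0 X) *: x2 X + cconj (cmul (x3 X) (x1 X)).
Proof.
rewrite {1}/x2 jmat_sqr (jmat_conj X 1 0) (jmat_conj X 2 1) !jmat_diag.
rewrite cmulZl cmul1 cmulZr cmulr1 cconj_mul scalerDl addrAC.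
by rewrite [X in X + _]addrC.
Qed.

Lemma x3_sqr X : x3 (jmul X X) =
  (xi 0 X + xi 1 X) *: x3 X + cconj (cmul (x1 X) (x2 X)).
Proof.
rewrite {1}/x3 jmat_sqr (jmat_conj X 0 2) (jmat_conj X 2 1) !jmat_diag.
by rewrite cmulZl cmul1 cmulZr cmulr1 cconj_mul scalerDl.
Qed.

(** The six coordinates of X o X express (X, X x X) through the xi i, the norms
    of the x_i and the real parts of the three cyclic products of the x_i, which
    agree by [ctriple_cycle]. *)
Lemma jdetE X : 3 != 0 :> K -> jdet X =
  xi 0 X * xi 1 X * xi 2 X - xi 0 X * cdot (x1 X) (x1 X)
  - xi 1 X * cdot (x2 X) (x2 X) - xi 2 X * cdot (x3 X) (x3 X)
  + 2 * ctriple (x1 X) (x2 X) (x3 X).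
Proof.
move=> three_neq0; rewrite /jdet jinnerE /jcross !(coordZ, coordD, coordN).
rewrite !coord_jdiag !scaler0 !addr0 !xi_sqr x1_sqr x2_sqr x3_sqr jinnerE.
rewrite /jtr sum3 -!/(xi _ X) !(linearZ_LR, linearD, linearN) /= !cdot_conj_mul.
rewrite -(ctriple_cycle (x1 X)) (ctriple_cycle (x3 X)).
by field; rewrite two_neq0.
Qed.

End Coordinates.

(** * The Peirce decomposition with respect to E1 *)

Section Peirce.
Variable K : fieldType.
Implicit Types (y z : cayley K) (X Y Z : jordan K) (s t k : K).
Hypotheses (two_neq0 : 2 != 0 :> K) (three_neq0 : 3 != 0 :> K).

Lemma coord_phi t X :
  ((xi 0 (phi t X) = t ^+ 4 * xi 0 X) * (xi 1 (phi t X) = t ^- 2 * xi 1 X)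
   * (xi 2 (phi t X) = t ^- 2 * xi 2 X))
  * ((x1 (phi t X) = t ^- 2 *: x1 X) * (x2 (phi t X) = t *: x2 X)
     * (x3 (phi t X) = t *: x3 X)).
Proof. by rewrite /xi /x1 /x2 /x3 !mxE. Qed.

(** In each of the five terms of the determinant the weights t^4, t^-2 and t
    of the coordinates multiply to 1. *)
Lemma jdet_phi t X : t != 0 -> jdet (phi t X) = jdet X.
Proof.
move=> t0; rewrite !jdetE // /ctriple !coord_phi !(cmulZl, cmulZr).
by rewrite !cdotZl !linearZ_LR /=; field.
Qed.

Lemma phi_linear t : linear (phi t).
Proof.
move=> k X Y; apply: coord_ext => // [i| | |].
  by elim/ord3P: i; rewrite coordD coordZ !coord_phi coordD coordZ; ring.
all: by rewrite coordD coordZ !coord_phi coordD coordZ scalerDr !scalerA mulrC.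
Qed.

Lemma phiD t X Y : phi t (X + Y) = phi t X + phi t Y.
Proof. by rewrite -[X]scale1r phi_linear !scale1r. Qed.

Lemma phiZ t k X : phi t (k *: X) = k *: phi t X.
Proof.
have phi0 : phi t 0 = 0 by apply: (addIr (phi t 0)); rewrite -phiD !add0r.
by rewrite -[k *: X]addr0 phi_linear phi0 addr0.
Qed.

Lemma phiM s t X : phi s (phi t X) = phi (s * t) X.
Proof.
apply: coord_ext => // [i| | |].
  by elim/ord3P: i; rewrite !coord_phi mulrA ?exprMn ?invfM.
all: by rewrite !coord_phi scalerA ?exprMn ?invfM.
Qed.

Lemma phi1 X : phi 1 X = X.
Proof.
apply: coord_ext => // [i| | |].
  by elim/ord3P: i; rewrite !coord_phi expr1n ?invr1 mul1r.
all: by rewrite !coord_phi ?expr1n ?invr1 scale1r.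
Qed.

Lemma sigmaE X : sigma X = phi (-1) X.
Proof.
apply: jordan_ext => i j; rewrite !mxE; congr (_ *: _).
rewrite /sigma_weight /phi_weight sqrrN expr1n invr1.
rewrite (_ : (-1) ^+ 4 = 1); last by ring.
by case: (i == 0); case: (j == 0).
Qed.

Definition peirce_half X := [/\ xi 0 X = 0, xi 1 X = 0, xi 2 X = 0 & x1 X = 0].
Definition peirce_zero X := [/\ xi 0 X = 0, x2 X = 0 & x3 X = 0].

Lemma peirce_decomposition X : exists H Z,
  [/\ peirce_half H, peirce_zero Z & X = xi 0 X *: jE1 + H + Z].
Proof.
exists (of_coord 0 0 0 0 (x2 X) (x3 X)).
exists (of_coord 0 (xi 1 X) (xi 2 X) (x1 X) 0 0).
split; [by split; rewrite of_coordE .. |].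
apply: coord_ext => // [i| | |].
  by elim/ord3P: i; rewrite !(coordD, coordZ) !of_coordE coord_E1 /=
    ?mulr1 ?mulr0 ?add0r ?addr0.
all: by rewrite !(coordD, coordZ) !of_coordE coord_E1 scaler0 ?add0r ?addr0.
Qed.

Lemma phi_E1 t : phi t jE1 = t ^+ 4 *: jE1 :> jordan K.
Proof.
apply: coord_ext => // [i| | |].
  by elim/ord3P: i; rewrite coordZ coord_phi coord_E1 /= ?mulr0.
all: by rewrite coordZ coord_phi coord_E1 !scaler0.
Qed.

Lemma phi_half t X : peirce_half X -> phi t X = t *: X.
Proof.
case=> X0 X1 X2 X3; apply: coord_ext => // [i| | |].
  by elim/ord3P: i; rewrite coordZ coord_phi ?(X0, X1, X2) !mulr0.
all: by rewrite coordZ coord_phi ?X3 ?scaler0.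
Qed.

Lemma phi_zero t X : peirce_zero X -> phi t X = t ^- 2 *: X.
Proof.
case=> X0 X2 X3; apply: coord_ext => // [i| | |].
  by elim/ord3P: i; rewrite coordZ coord_phi ?X0 ?mulr0.
all: by rewrite coordZ coord_phi ?(X2, X3) ?scaler0.
Qed.

(** On the zero space this is the nondegenerate form of dimension 10 on which
    Spin(10) acts. *)
Definition spin_form X : K := xi 1 X * xi 2 X - cdot (x1 X) (x1 X).

(** The first coordinate enters the determinant linearly, with coefficient the
    spin form; so the form is defined from E1 and the determinant alone and is
    invariant under every map that preserves both. *)
Lemma spin_formE X : jdet (jE1 + X) - jdet X = spin_form X.
Proof.
by rewrite !jdetE // /spin_form !coordD !coord_E1 /= !add0r; ring.
Qed.

Definition polar X Y : K := spin_form (X + Y) - spin_form X - spin_form Y.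

Lemma polarE X Y : polar X Y =
  xi 1 X * xi 2 Y + xi 2 X * xi 1 Y - 2 * cdot (x1 X) (x1 Y).
Proof.
rewrite /polar /spin_form !coordD linearD /=.
rewrite [cdot (_ + _) (x1 X)]cdotC [cdot (_ + _) (x1 Y)]cdotC.
by rewrite !linearD /= [cdot (x1 Y) (x1 X)]cdotC; ring.
Qed.

Definition radical X := forall Y, polar X Y = 0.

Lemma radicalP X : radical X <-> [/\ xi 1 X = 0, xi 2 X = 0 & x1 X = 0].
Proof.
split=> [X0|[X1 X2 X3] Y]; last first.
  by rewrite polarE X1 X2 X3 cdotC linear0 !mul0r mulr0 subr0 addr0.
split.
- have := X0 (of_coord 0 0 1 0 0 0).
  by rewrite polarE !of_coordE linear0 !mulr0 mulr1 addr0 oppr0 addr0.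
- have := X0 (of_coord 0 1 0 0 0 0).
  by rewrite polarE !of_coordE linear0 !mulr0 mulr1 add0r oppr0 addr0.
apply: cdot_nondegenerate => y.
have := X0 (of_coord 0 0 0 y 0 0); rewrite polarE !of_coordE !mulr0 !add0r cdotC.
by move/eqP; rewrite oppr_eq0 mulf_eq0 (negPf two_neq0) => /eqP.
Qed.

Lemma jdet_E1_half X : peirce_half X -> jdet (jE1 + X) = 0.
Proof.
move=> [X0 X1 X2 X3].
rewrite jdetE // !coordD !coord_E1 /= !add0r X0 X1 X2 X3 linear0.
by rewrite /ctriple !cmul0 linear0 !mulr0 !mul0r !subr0 addr0.
Qed.

(** Write (y, z) for the element of the half space with entries x2 = y, x3 = z.
    As x2 Y = x3 Y = 0, the determinant of Y + (y, z) is
    (xi 0) q - (xi 1) N(y) - (xi 2) N(z) + 2 Re((x1 y) z), where q is the spin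
    form of Y and N is the norm. It vanishes at (0, 0), (1, 0), (0, 1) and
    (y, 1), which gives successively (xi 0) q = 0, xi 1 = 0, xi 2 = 0 and
    x1 = 0. *)
Lemma E1_characterization Y : x2 Y = 0 -> x3 Y = 0 ->
  (forall X, peirce_half X -> jdet (Y + X) = 0) -> Y = xi 0 Y *: jE1.
Proof.
move=> Y2 Y3 det0.
have D y z : xi 0 Y * spin_form Y - xi 1 Y * cdot y y - xi 2 Y * cdot z z
             + 2 * ctriple (x1 Y) y z = 0.
  rewrite -(det0 (of_coord 0 0 0 0 y z)); last by split; rewrite of_coordE.
  rewrite jdetE // !coordD !of_coordE Y2 Y3 !add0r !addr0 /spin_form.
  by ring.
have dot00 : cdot (0 : cayley K) 0 = 0 by rewrite linear0.
have dot11 : cdot (cone K) (cone K) = 1 by rewrite cdotE /=; ring.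
have triple0 x y : ctriple x y 0 = 0 :> K by rewrite /ctriple cmulr0.
have triple0m x y : ctriple x 0 y = 0 :> K by rewrite /ctriple cmulr0 cmul0.
have xi1q : xi 0 Y * spin_form Y = 0.
  by have := D 0 0; rewrite dot00 triple0 !mulr0 oppr0 !addr0.
have Yxi1 : xi 1 Y = 0.
  have := D (cone K) 0; rewrite xi1q dot00 dot11 triple0 !mulr0 mulr1 oppr0.
  by rewrite !addr0 add0r => /eqP; rewrite oppr_eq0 => /eqP.
have Yxi2 : xi 2 Y = 0.
  have := D 0 (cone K); rewrite xi1q dot00 dot11 triple0m !mulr0 mulr1 oppr0.
  by rewrite !addr0 add0r => /eqP; rewrite oppr_eq0 => /eqP.
have Yx1 : x1 Y = 0.
  apply: cdot_nondegenerate => y; rewrite cdotC.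
  have := D (cconj y) (cone K); rewrite xi1q Yxi1 Yxi2 !mul0r !oppr0 !add0r.
  by rewrite /ctriple cmulr1 => /eqP; rewrite mulf_eq0 (negPf two_neq0) => /eqP.
apply: coord_ext => // [i| | |].
  by elim/ord3P: i; rewrite coordZ coord_E1 ?Yxi1 ?Yxi2 /= ?mulr0 ?mulr1.
all: by rewrite coordZ coord_E1 scaler0 ?Yx1.
Qed.

End Peirce.

(** * The groups E6, (E6)_{E1} and the centralizer of sigma *)

Section Groups.
Variable R : realType.
Local Notation C := R[i].
Local Notation JC := (jordan C).
Local Notation conj_cayley := (cmap (@conjc R)).
Implicit Types (X Y Z : JC) (d e : E6 R) (a b : E6_sigma R) (t : C).

Let two_neq0 : 2 != 0 :> C. Proof. by rewrite pnatr_eq0. Qed.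
Let three_neq0 : 3 != 0 :> C. Proof. by rewrite pnatr_eq0. Qed.

Lemma jhermE X Y : jherm X Y =
  conjc (xi 0 X) * xi 0 Y + conjc (xi 1 X) * xi 1 Y + conjc (xi 2 X) * xi 2 Y
  + 2 * (cdot (conj_cayley (x1 X)) (x1 Y) + cdot (conj_cayley (x2 X)) (x2 Y)
         + cdot (conj_cayley (x3 X)) (x3 Y)).
Proof. by rewrite /jherm jinnerE // /jtau /xi /x1 /x2 /x3 !mxE. Qed.

Lemma jherm_E1 X : jherm jE1 X = xi 0 X.
Proof.
rewrite jhermE !coord_E1 cmap0 !(cdotC 0) !linear0 !rmorph_nat.
by rewrite mul1r !mul0r !addr0 mulr0 addr0.
Qed.

Lemma jherm_phi t X Y : `|t| = 1 -> jherm (phi t X) (phi t Y) = jherm X Y.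
Proof.
move=> t1; have t0 : t != 0 by rewrite -normr_eq0 t1 oner_eq0.
have conj_t : conjc t = t^-1.
  by apply: (mulfI t0); rewrite -sqr_normc t1 expr1n divff.
rewrite !jhermE !coord_phi !cmapZ !cdotZl !linearZ_LR /=.
by rewrite !(rmorphM, fmorphV, rmorphXn) /= conj_t; field.
Qed.

Lemma E6_linear d : linear d.
Proof. by case: (asboolW (autP d)). Qed.

Lemma E6_D d X Y : d (X + Y) = d X + d Y.
Proof. by rewrite -[X]scale1r E6_linear !scale1r. Qed.

Lemma E6_Z d k X : d (k *: X) = k *: d X.
Proof.
have d0 : d 0 = 0 by apply: (addIr (d 0)); rewrite -E6_D !add0r.
by rewrite -[k *: X]addr0 E6_linear d0 addr0.
Qed.

Lemma E6_det d X : jdet (d X) = jdet X.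
Proof. by case: (asboolW (e6P d)). Qed.

Lemma E6_herm d X Y : jherm (d X) (d Y) = jherm X Y.
Proof. by case: (asboolW (e6P d)). Qed.

Lemma E6_sigma_ext a b : (forall X, a X = b X) -> a = b.
Proof. by move=> ab; apply/val_inj/val_inj/val_inj/funext. Qed.

Lemma E6_sigma_mulE a b X : (a * b)%g X = a (b X).
Proof. by rewrite valM. Qed.

Lemma E6_sigma_invVK a X : a (a^-1%g X) = X.
Proof. by rewrite -E6_sigma_mulE mulgV. Qed.

Lemma Spin10_mulE (c d : Spin10 R) X : (c * d)%g X = c (d X).
Proof. by rewrite valM. Qed.

Lemma Spin10_E1 (d : Spin10 R) : d jE1 = jE1.
Proof. by apply/eqP; case: d. Qed.

Section Stabilizer.
Variable d : E6 R.
Hypothesis dE1 : d jE1 = jE1.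

Lemma stab_spin_form X : spin_form (d X) = spin_form X.
Proof.
rewrite -(spin_formE two_neq0 three_neq0 X) -(spin_formE two_neq0 three_neq0 (d X)).
have -> : jE1 + d X = d (jE1 + X) by rewrite E6_D dE1.
by rewrite !(E6_det d).
Qed.

Lemma stab_radical X : radical X -> radical (d X).
Proof.
move=> X0 Y; rewrite -[Y](E6_invVK d) /polar -(E6_D d) !stab_spin_form.
exact: X0.
Qed.

(** The half space is the part of the radical that is orthogonal to E1. *)
Lemma stab_half X : peirce_half X -> peirce_half (d X).
Proof.
move=> [X0 X1 X2 X3].
have /stab_radical/(radicalP two_neq0)[Y1 Y2 Y3] : radical X.
  exact/(radicalP two_neq0).
by split=> //; rewrite -jherm_E1 -dE1 E6_herm jherm_E1.
Qed.

End Stabilizer.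

Lemma conj_cayleyK : involutive (conj_cayley : cayley C -> cayley C).
Proof.
case=> [[a0 a1 a2 a3] [a4 a5 a6 a7]].
by apply: cayley_ext; apply: conjcK.
Qed.

Lemma peirce_zeroP X : peirce_zero X <-> forall Y, radical Y -> jherm Y X = 0.
Proof.
split=> [[X0 X2 X3] Y /(radicalP two_neq0)[Y1 Y2 Y3]|hX].
  rewrite jhermE X0 X2 X3 Y1 Y2 Y3 cmap0 (cdotC 0) !linear0.
  by rewrite !mul0r mulr0 !addr0 mulr0 addr0.
have rad k y z : radical (of_coord k 0 0 0 y z : JC).
  by apply/(radicalP two_neq0); rewrite !of_coordE.
split.
- by rewrite -jherm_E1; apply: hX; apply/(radicalP two_neq0); rewrite !coord_E1.
- apply: cdot_nondegenerate => y; have := hX _ (rad 0 (conj_cayley y) 0).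
  rewrite jhermE !of_coordE conj_cayleyK cmap0 !(cdotC 0) !linear0.
  rewrite !mul0r !add0r addr0.
  by move/eqP; rewrite mulf_eq0 (negPf two_neq0) => /eqP.
- apply: cdot_nondegenerate => y; have := hX _ (rad 0 0 (conj_cayley y)).
  rewrite jhermE !of_coordE conj_cayleyK cmap0 !(cdotC 0) !linear0.
  rewrite !mul0r !add0r.
  by move/eqP; rewrite mulf_eq0 (negPf two_neq0) => /eqP.
Qed.

Lemma stab_zero d X : d jE1 = jE1 -> peirce_zero X -> peirce_zero (d X).
Proof.
move=> dE1 /peirce_zeroP hX; apply/peirce_zeroP => Y Y0.
rewrite -(E6_invVK d Y) E6_herm; apply/hX/stab_radical => //.
by rewrite -{1}dE1 E6_invK.
Qed.

(** Both maps preserve the three Peirce spaces, and phi t is a scalar on each. *)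
Lemma stab_phi d t X : d jE1 = jE1 -> d (phi t X) = phi t (d X).
Proof.
move=> dE1; have [H [Z [hH hZ ->]]] := peirce_decomposition two_neq0 X.
rewrite !(phiD two_neq0, E6_D) !(phiZ two_neq0, E6_Z) dE1 !phi_E1 //.
rewrite [phi t H]phi_half // [phi t Z]phi_zero // !E6_Z dE1.
by rewrite [phi t (d H)]phi_half ?[phi t (d Z)]phi_zero //;
  [exact: stab_zero | exact: stab_half].
Qed.

Lemma centr_sigma a X : sigma (a X) = a (sigma X).
Proof. exact: (asboolW (e6sP a)). Qed.

Lemma eq_opp_eq0 (V : lmodType C) (v : V) : v = - v -> v = 0.
Proof.
move=> vN; apply: (scalerI two_neq0).
by rewrite scaler0 scaler_nat mulr2n {2}vN subrr.
Qed.

Lemma centr_half a X : peirce_half X -> peirce_half (a X).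
Proof.
move=> hX.
have aN : phi (-1) (a X) = - a X.
  rewrite -sigmaE centr_sigma sigmaE phi_half // scaleN1r -[- X]scaleN1r E6_Z.
  by rewrite scaleN1r.
have E i : xi i (phi (-1) (a X)) = - xi i (a X) by rewrite aN coordN.
split.
- have := E 0; rewrite coord_phi (exprM _ 2 2) sqrrN !expr1n mul1r.
  exact: (@eq_opp_eq0 C^o).
- have := E 1; rewrite coord_phi sqrrN expr1n invr1 mul1r.
  exact: (@eq_opp_eq0 C^o).
- have := E 2; rewrite coord_phi sqrrN expr1n invr1 mul1r.
  exact: (@eq_opp_eq0 C^o).
- apply: eq_opp_eq0; rewrite -[RHS](coordN (a X)) -aN coord_phi.
  by rewrite sqrrN expr1n invr1 scale1r.
Qed.

Lemma centr_E1 a : exists2 t : C, `|t| = 1 & a jE1 = t *: jE1.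
Proof.
have s1 : sigma (a jE1) = a jE1.
  by rewrite centr_sigma sigmaE phi_E1 // (exprM _ 2 2) sqrrN !expr1n scale1r.
have aE1 : a jE1 = xi 0 (a jE1) *: jE1.
  apply: E1_characterization => //.
  - by apply: eq_opp_eq0; rewrite -{1}s1 sigmaE coord_phi scaleN1r.
  - by apply: eq_opp_eq0; rewrite -{1}s1 sigmaE coord_phi scaleN1r.
  move=> X hX; rewrite -(E6_sigma_invVK a X) -E6_D E6_det jdet_E1_half //.
  exact: centr_half.
exists (xi 0 (a jE1)) => //; move: aE1; set t := xi 0 _ => aE1.
have := E6_herm a jE1 jE1.
rewrite aE1 jherm_E1 coord_E1 jhermE !coordZ !coord_E1.
rewrite !scaler0 !linear0 /= !mulr0 !addr0 !mulr0 addr0 !mulr1 => tt.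
by apply/eqP; rewrite -(@pexpr_eq1 _ _ 2) // sqr_normc mulrC tt.
Qed.

(** * The morphism from U(1) x Spin(10) *)

Lemma phi_lin_aut t : t != 0 -> `[< linear (phi t) /\ bijective (phi t) >].
Proof.
move=> t0; apply/asboolT; split; first exact: phi_linear.
by exists (phi t^-1) => X; rewrite phiM // ?mulVf ?mulfV // phi1.
Qed.

Lemma U1_neq0 (s : U1 R) : (s : C) != 0.
Proof. by rewrite -normr_eq0 (eqP (u1P s)) oner_eq0. Qed.

Definition phi_aut (s : U1 R) : lin_aut JC := LinAut (phi_lin_aut (U1_neq0 s)).

Lemma phi_aut_E6 s : in_E6 (phi_aut s).
Proof.
apply/asboolT; split=> X; first by rewrite jdet_phi // U1_neq0.
by move=> Y; rewrite jherm_phi // (eqP (u1P s)).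
Qed.

Definition phi_E6 s : E6 R := InE6 (phi_aut_E6 s).

Lemma phi_mul_centr (s : U1 R) (d : Spin10 R) : in_E6_sigma (phi_E6 s * d)%g.
Proof.
apply/asboolT => X; rewrite !E6_mulE /= sigmaE phiM // mulrC -phiM //.
by rewrite -(stab_phi (-1) _ (Spin10_E1 d)) sigmaE.
Qed.

Definition phi_mul (p : U1 R * Spin10 R) : E6_sigma R :=
  InE6Sigma (phi_mul_centr p.1 p.2).

Lemma phi_mulE p X : phi_mul p X = phi (p.1 : C) (p.2 X).
Proof. exact: (E6_mulE (phi_E6 p.1) p.2). Qed.

Lemma phi_mulM : {morph phi_mul : p q / (p * q)%g}.
Proof.
move=> [s d] [t e]; apply: E6_sigma_ext => X.
rewrite E6_sigma_mulE !phi_mulE -[LHS]/(phi ((s : C) * t) ((d * e)%g X)).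
by rewrite Spin10_mulE (stab_phi _ _ (Spin10_E1 d)) phiM.
Qed.

Lemma phi_mul_surjective a : exists p, phi_mul p = a.
Proof.
have [y y1 aE1] := centr_E1 a.
have t4 := rootCK (isT : (0 < 4)%N) y.
set t := 4.-root y in t4.
have t1 : `|t| == 1 by rewrite -(@pexpr_eq1 _ _ 4) // -normrX t4 y1.
pose s := UnitComplex t1.
have fixE1 : fixes_E1 ((phi_E6 s)^-1 * a)%g.
  apply/eqP; rewrite E6_mulE aE1 -t4 -[t]/(s : C) -phi_E1 //.
  exact: (E6_invK (phi_E6 s)).
exists (s, InSpin10 fixE1); apply: E6_sigma_ext => X.
by rewrite phi_mulE [X in phi _ X]E6_mulE; apply: (E6_invVK (phi_E6 s)).
Qed.

Lemma fourth_rootP t : t ^+ 4 = 1 -> [\/ t = 1, t = -1, t = 'i | t = - 'i].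
Proof.
move=> t4; have : (t - 1) * (t + 1) * ((t - 'i) * (t + 'i)) == 0.
  rewrite -!subr_sqr sqrCi (_ : _ * _ = t ^+ 4 - 1); last by ring.
  by rewrite t4 subrr.
rewrite !mulf_eq0 !subr_eq0 !addr_eq0.
by case/orP=> /orP[] /eqP;
  [constructor 1 | constructor 2 | constructor 3 | constructor 4].
Qed.

(** If phi s * d = 1, evaluation at E1 gives s^4 = 1, so s is one of the four
    fourth roots of unity, and d is phi of its inverse. *)
Lemma phi_mul_kernel (p : U1 R * Spin10 R) : Z4 p <-> phi_mul p = 1%g.
Proof.
case: p => s d.
have in_kernel t : (s : C) * t = 1 -> d =1 phi t -> phi_mul (s, d) = 1%g.
  by move=> st dt; apply: E6_sigma_ext => X; rewrite phi_mulE /= dt phiM // st phi1.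
split=> [|p1].
  case=> [] [/= sE dE]; apply: in_kernel dE; rewrite sE ?mulr1 ?mulrNN ?mulr1 //.
    by rewrite mulrN -expr2 sqrCi opprK.
  by rewrite mulNr -expr2 sqrCi opprK.
have sd X : phi (s : C) (d X) = X by rewrite -(phi_mulE (s, d)) p1.
have dE t : t * (s : C) = 1 -> d =1 phi t.
  by move=> ts X; rewrite -{2}[X]sd phiM // ts phi1.
have s4 : (s : C) ^+ 4 = 1.
  have := sd jE1; rewrite Spin10_E1 phi_E1 // => /(congr1 (xi 0)).
  by rewrite coordZ coord_E1 mulr1.
have [] := fourth_rootP s4 => sE.
- by apply: Or41; split=> //; apply: dE; rewrite sE mulr1.
- by apply: Or42; split=> //; apply: dE; rewrite sE mulrNN mulr1.
- by apply: Or43; split=> //; apply: dE; rewrite sE mulNr -expr2 sqrCi opprK.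
- by apply: Or44; split=> //; apply: dE; rewrite sE mulrN -expr2 sqrCi opprK.
Qed.

End Groups.

Theorem theorem3p10p7 (R : realType) :
  exists nZ : normal_subgroup (@Z4 R),
    isomorphic (E6_sigma R) (quotient_group nZ).
Proof.
exists (kernel_normal (@phi_mulM R) (@phi_mul_kernel R)).
apply: (first_isomorphism (@phi_mulM R) (@phi_mul_kernel R)).
exact: (@phi_mul_surjective R).
Qed.
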